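(* Suppose that $X$ is a Tychonoff space and $\Delta^c_X=(X\times X)\setminus\Delta_X$ is discretely $\sigma$-compact. (a) If $X$ is pseudocompact, then it is compact and metrizable. (b) If $X$ is a Lindelöf $\Sigma$-space, then it is cosmic.
   Context: All spaces are topological spaces assumed to be $T_1$. $\Delta_X=\{(x,x):x\in X\}$ is the diagonal of $X$. A space $Z$ is discretely $\sigma$-compact if the closure (in $Z$) of every discrete subset $D\subset Z$ (i.e. $D$ discrete in its subspace topology) is $\sigma$-compact. A family $\mathcal{F}$ of subsets of $X$ is a network modulo a cover $\mathcal{C}$ of $X$ if for any $C\in\mathcal{C}$ and any open $U\supset C$ there exists $F\in\mathcal{F}$ such that $C\subset F\subset U$. A Tychonoff space $X$ is a Lindelöf $\Sigma$-space if there exists a countable family $\mathcal{F}$ of subsets of $X$ that is a network modulo a cover $\mathcal{C}$ of $X$ consisting of compact sets. A family $\mathcal{N}$ of subsets of $X$ is a network of $X$ if every open subset of $X$ is the union of some subfamily of $\mathcal{N}$. A space is cosmic if it has a countable network. *)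

(* Defs.v *)
From HB Require Import structures.
From mathcomp Require Import all_boot all_order all_algebra.
From mathcomp Require Import all_classical all_reals.
From mathcomp Require Import topology normedtype.

Set Implicit Arguments.
Unset Strict Implicit.
Unset Printing Implicit Defensive.

Import Order.TTheory GRing.Theory Num.Theory.
Import numFieldNormedType.Exports.

Local Open Scope classical_set_scope.
Local Open Scope ring_scope.

(* [completely_regular_space] separates points from closed sets by
   [uniform_separator]; by [uniform_separatorP] this is separation by a
   continuous function into [0, 1]. *)
Definition tychonoff_space (X : topologicalType) : Prop :=
  accessible_space X /\ completely_regular_space X.

(* [D] coerces to the type of its elements, carrying the subspace topology. *)
Definition discrete_subset (Z : topologicalType) (D : set Z) : Prop :=
  forall A : set D, open A.

Definition sigma_compact (Z : topologicalType) (A : set Z) : Prop :=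
  exists2 K : nat -> set Z, (forall n, compact (K n)) & A = \bigcup_n K n.

Definition discretely_sigma_compact (Z : topologicalType) : Prop :=
  forall D : set Z, discrete_subset D -> sigma_compact (closure D).

(* The complement of the diagonal as a space in its own right, so that closures
   of its subsets are taken in it and not in [X * X]. *)
Definition offdiagonal (X : topologicalType) : topologicalType :=
  set_type (~` @diagonal X).

Definition pseudocompact (R : realType) (X : topologicalType) : Prop :=
  forall f : X -> R, continuous f -> bounded_fun f.

Definition metrizable (R : realType) (X : topologicalType) : Prop :=
  exists m : Metric.axioms_ R X,
    let M := Metric.Pack m in forall x : X, @nbhs M M x = @nbhs X X x.

Definition network_modulo (X : topologicalType) (F C : set (set X)) : Prop :=
  forall K U : set X, C K -> open U -> K `<=` U ->
    exists A : set X, [/\ F A, K `<=` A & A `<=` U].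

Definition lindelof_sigma_space (X : topologicalType) : Prop :=
  tychonoff_space X /\
  exists F C : set (set X),
    [/\ countable F, cover C id = [set: X], C `<=` compact
      & network_modulo F C].

Definition network (X : topologicalType) (N : set (set X)) : Prop :=
  forall U : set X, open U ->
    exists2 M : set (set X), M `<=` N & U = \bigcup_(A in M) A.

Definition cosmic (X : topologicalType) : Prop :=
  exists2 N : set (set X), countable N & network N.

(* Main.v *)
From HB Require Import structures.
Require Import Defs.
From mathcomp Require Import all_boot all_order all_algebra.
From mathcomp Require Import all_classical all_reals.
From mathcomp Require Import topology normedtype.
From mathcomp Require Import interval_inference lra.
From mathcomp Require wochoice.
Import numFieldNormedType.Exports.
Local Open Scope classical_set_scope.

(** Write Z for the complement of the diagonal in X * X. Everything follows
    from the Lindelof property of Z ([offdiagonal_lindelof]). Cover Z by the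
    open sets {(x, y) : f x < 1/2 < f y}, f ranging over the continuous
    functions X -> [0, 1]; a countable subcover is a sequence of functions that
    separates the points of X ([separating_sequence_exists]).

    The Lindelof property is reached from below, through compact subsets Q of X.

    - A discrete A inside Q is countable: A * A minus the diagonal is discrete,
      so its closure in Z, which contains every pair of distinct points of
      cl A, is sigma-compact. Hence countably many pairs of disjoint open sets
      separate the points of the compact set cl A, and finitely many of them
      isolate each point of A.
    - Therefore Q is countably tight: a non-closed A inside Q that contains the
      closures of its countable subsets would yield, by recursion along
      omega_1, an uncountable discrete subset. Countable tightness passes from
      Q to Q * Q by projecting along compact fibres.
    - If some open cover of Z had no countable subcover, a recursion along
      omega_1 would pick points p_i of Z outside the closure of the earlier
      points and outside countable unions O_j of members of the cover, j < i,
      where O_j contains the closure in Z of the points up to p_j. The range of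
      p is discrete, so uncountably many p_i lie in one compact subset of Z,
      hence in Q * Q for some compact Q. By countable tightness of Q * Q the
      union of the closures of the countable initial pieces of this subsequence
      is closed, so it is compact, so finitely many O_j cover it; but a late
      p_i avoids them.

    Given a separating sequence (f_n), part (b) intersects the members of a
    countable network modulo compact sets with finitely many sets {f_n < 1/2}.
    For part (a), rho(x, y) = sup_n |f_n x - f_n y| / (n + 1) is a continuous
    metric. A positive continuous function on a pseudocompact space is bounded
    away from 0, because its inverse is bounded. Applied to rho(x, -) + g, with
    g x = 1 and g = 0 off a neighbourhood of x, this shows that rho induces the
    topology; applied to the distance to the coordinatewise limit of an
    ultrafilter, it shows that this limit is attained at a point of X. *)

Set Implicit Arguments.
Unset Strict Implicit.
Unset Printing Implicit Defensive.
Import Order.TTheory GRing.Theory Num.Theory.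

(** * Recursion along the first uncountable ordinal *)

Lemma countable_setU (T : Type) (A B : set T) :
  countable A -> countable B -> countable (A `|` B).
Proof.
move=> cA cB; rewrite -bigcup2E; apply: bigcup_countable => // -[|[|i]] _ //=.
Qed.

Definition omega1_order (I : Type) (lt : I -> I -> Prop) : Prop :=
  [/\ well_founded lt, forall i j k, lt i j -> lt j k -> lt i k,
      forall i j, [\/ lt i j, i = j | lt j i], ~ countable [set: I]
    & forall i, countable [set j | lt j i]].

(** Cantor's diagonal argument. *)
Lemma not_countable_set_nat : ~ countable [set: set nat].
Proof.
move=> /countable_injP[f finj].
pose A := [set n | exists B : set nat, f B = n /\ ~ B n].
have [AfA|nAfA] := pselect (A (f A)); last first.
  by apply: (nAfA); exists A; split=> //; exact: nAfA.
have [B [fBA nB]] := AfA; apply: nB.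
by rewrite (finj B A _ _ fBA) ?inE.
Qed.

(** Well-order the uncountable type of sets of natural numbers and keep the
    elements with countably many predecessors. If these were countable, the
    least element outside them would be one of them. *)
Lemma omega1_order_exists :
  exists (I : Type) (lt : I -> I -> Prop), omega1_order lt.
Proof.
have [R wR] := wochoice.well_ordering_principle {classic set nat}.
pose T : Type := {classic set nat}.
have min_ex (A : set T) : A !=set0 ->
    exists2 z, A z & forall x, A x -> R z x.
  move=> [x Ax]; have [|z [[Az zmin] _]] := wR (fun y => `[< A y >]).
    by exists x; rewrite unfold_in; apply/asboolP.
  exists z; first by move: Az; rewrite unfold_in => /asboolP.
  by move=> y Ay; apply: zmin; rewrite unfold_in; apply/asboolP.
have Rxx x : R x x.
  by have [|_ -> xmin] := min_ex [set x]; [exists x|apply: xmin].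
have Rtot x y : R x y \/ R y x.
  have [|z [->|->] zm] := min_ex [set x; y]; first by exists x; left.
    by left; apply: zm; right.
  by right; apply: zm; left.
have Ranti x y : R x y -> R y x -> x = y.
  move=> xy yx; have [|z [_ uz]] := wR (fun z => `[< z = x \/ z = y >]).
    by exists x; rewrite unfold_in; apply/asboolP; left.
  have -> : x = z.
    symmetry; apply: uz; split; first by rewrite unfold_in; apply/asboolP; left.
    by move=> w; rewrite unfold_in => /asboolP[->|->].
  apply: uz; split; first by rewrite unfold_in; apply/asboolP; right.
  by move=> w; rewrite unfold_in => /asboolP[->|->].
pose lt x y := R x y /\ x <> y.
have ltNR x y : ~ lt x y -> R y x.
  move=> nxy; case: (Rtot x y) => // xy.
  by have [->|nexy] := pselect (x = y); [exact: Rxx|case: nxy].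
have ltR x y : lt x y -> R y x -> False.
  by move=> [xy nexy] yx; apply: nexy; exact: Ranti.
have lt_trans x y z : lt x y -> lt y z -> lt x z.
  move=> xy yz; apply: contrapT => /ltNR zx.
  have [|m m3 mmin] := min_ex [set x; y; z]; first by exists x; left; left.
  move: m3 mmin => [[->|->]|->] mmin.
  - have xz : R x z by apply: mmin; right.
    have zE := Ranti _ _ xz zx; subst z.
    by apply: ltR yz _; case: xy.
  - by apply: (ltR _ _ xy); apply: mmin; left; left.
  - by apply: (ltR _ _ yz); apply: mmin; left; right.
(* J is the initial segment of type omega_1. *)
pose J := [set i : T | countable [set j | lt j i]].
have Jdown i j : J i -> lt j i -> J j.
  move=> Ji ji; apply: sub_countable Ji; apply: subset_card_le => k kj.
  exact: lt_trans kj ji.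
have Junc : ~ countable J.
  move=> cJ; have [JT|] := pselect (forall i, J i).
    apply: not_countable_set_nat; apply: sub_countable cJ.
    by apply: subset_card_le => x _; exact: JT.
  move=> /existsNP[i0 nJi0].
  have [|i nJi imin] := min_ex (~` J); first by exists i0.
  apply: nJi; apply: sub_countable cJ; apply: subset_card_le => j ji.
  by apply: contrapT => /imin; exact: ltR ji.
exists (set_type J), (fun x y => lt (\val x) (\val y)); split.
- move=> [x xJ]; apply: contrapT => nacc.
  pose B := [set y : T | exists h : y \in J,
    ~ Acc (fun x y : set_type J => lt (\val x) (\val y)) (SigSub h)].
  have [|y [yJ nacy] ymin] := min_ex B; first by exists x, xJ.
  apply: nacy; constructor => -[z zJ] /= zy; apply: contrapT => nz.
  by apply: (ltR _ _ zy); apply: ymin; exists zJ.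
- by move=> i j k; exact: lt_trans.
- move=> i j; have [ij|/ltNR ji] := pselect (lt (\val i) (\val j)).
    by constructor 1.
  have [ij|nij] := pselect (i = j); first by constructor 2.
  constructor 3; split=> // e; apply: nij.
  by apply: val_inj; symmetry.
- by rewrite (eq_countable (card_setT _)).
- move=> i; have := set_valP i => Ji.
  have /countable_injP[f finj] : countable [set j | lt j (\val i)] by exact: Ji.
  apply/countable_injP; exists (f \o \val) => x y; rewrite !inE => xi yi fxy.
  by apply: val_inj; apply: finj => //; rewrite inE.
Qed.

(** Since proper initial segments are countable, a choice that is possible after
    any countable set of earlier choices can be repeated omega_1 times. *)
Lemma omega1_recursion (I : Type) (lt : I -> I -> Prop) (T : Type)
    (P : set T -> T -> Prop) :
  omega1_order lt -> (forall S, countable S -> exists t, P S t) ->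
  exists t : I -> T, forall i, P (t @` [set j | lt j i]) (t i).
Proof.
move=> [wf _ _ _ cseg] /= nextP.
have [s Ps] : exists s : set T -> T, forall S, countable S -> P S (s S).
  have [t0 _] := nextP set0 (countable0 _).
  have H S : exists t, countable S -> P S t.
    have [/nextP[t Pt]|nc] := pselect (countable S); first by exists t.
    by exists t0.
  by exists (fun S => projT1 (cid (H S))) => S; exact: (projT2 (cid (H S))).
pose F i (rec : forall j, lt j i -> T) :=
  s [set t | exists j (ji : lt j i), rec j ji = t].
pose t := Fix wf (fun _ => T) F.
have tE i : t i = s (t @` [set j | lt j i]).
  rewrite /t Fix_eq => [|j f g fg].
    congr s; apply/seteqP; split => [_ [j [ji <-]]|_ [j ji <-]]; first by exists j.
    by exists j, ji.
  congr s; apply/seteqP; split => [_ [k [kj <-]]|_ [k [kj <-]]].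
    by exists k, kj; rewrite fg.
  by exists k, kj; rewrite fg.
exists t => i; rewrite [X in P _ X]tE; apply: Ps.
by apply: sub_countable (cseg i); exact: card_image_le.
Qed.

(** Omega_1 has uncountable cofinality. *)
Lemma omega1_bounded (I : Type) (lt : I -> I -> Prop) (J : set I) :
  omega1_order lt -> countable J -> exists i, forall j, J j -> lt j i.
Proof.
move=> [_ _ tot unc cseg] cJ; apply: contrapT => /forallNP nb; apply: unc.
have : countable (\bigcup_(j in J) ([set k | lt k j] `|` [set j])).
  by apply: bigcup_countable => // j _; apply: countable_setU.
apply: sub_countable; apply: subset_card_le => i _.
have /existsNP[j /not_implyP[Jj nji]] := nb i; exists j => //.
by case: (tot j i) => [//|->|ij]; [right|left].
Qed.

(** * Discrete subsets and countable subcovers *)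

Definition relatively_discrete (T : topologicalType) (D : set T) : Prop :=
  forall p, D p -> exists U, [/\ open U, U p & forall q, D q -> U q -> q = p].

(** Discrete sigma-compactness of the subspace Z, phrased with sets of the
    ambient space only. *)
Definition discretely_sigma_compact_in (T : topologicalType) (Z : set T) :=
  forall D : set T, D `<=` Z -> relatively_discrete D ->
  exists K : nat -> set T, [/\ forall n, compact (K n), forall n, K n `<=` Z
    & closure D `&` Z `<=` \bigcup_n K n].

Lemma discretely_sigma_compact_subspace (T : topologicalType) (Z : set T) :
  discretely_sigma_compact (set_type Z : topologicalType) ->
  discretely_sigma_compact_in Z.
Proof.
move=> hZ D DZ Ddisc; pose D' : set (set_type Z) := \val @^-1` D.
have val_cts : continuous (\val : set_type Z -> T) by exact: initial_continuous.
have [|K cK KE] := hZ D'.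
  move=> A; pose U0 := \bigcup_(U in [set U | open U /\
    exists2 p : set_type D', A p & forall q, D q -> U q -> q = \val (\val p)]) U.
  exists (\val @^-1` U0).
    by exists U0 => //; apply: bigcup_open => U [].
  apply/seteqP; split=> [p [U [oU [q Aq Uq] Up]]|p Ap] /=.
    suff -> : p = q by [].
    by do 2 apply: val_inj; apply: Uq => //; exact: (set_valP p).
  have [U [oU Up Uuniq]] := Ddisc _ (set_valP p).
  by exists U => //; split=> //; exists p.
exists (fun n => \val @` K n); split=> [n|n _ [z _ <-]|p [clp Zp]].
- by apply: continuous_compact; [exact: continuous_subspaceT|exact: cK].
- exact: (set_valP z).
- have : closure D' (SigSub (mem_set Zp)).
    move=> B [_ [[U oU <-] /= Up UB]].
    have [|q [Dq Uq]] := clp U; first by apply: open_nbhs_nbhs; split.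
    by exists (SigSub (mem_set (DZ _ Dq))); split=> //; exact: UB.
  by rewrite KE => -[n _ Kn]; exists n => //; eexists; first exact: Kn.
Qed.

Lemma compact_finite_subcover (T : topologicalType) (I : Type) (K : set T)
    (W : set I) (f : I -> set T) :
  compact K -> (forall i, W i -> open (f i)) -> K `<=` \bigcup_(i in W) f i ->
  exists W' : set I,
    [/\ finite_set W', W' `<=` W & K `<=` \bigcup_(i in W') f i].
Proof.
move=> cK oW KW; apply: contrapT => /forallNP nfin.
(* A cluster point of the filter generated by the complements of the finite
   subunions lies in K and in no member of the cover. *)
pose F : set_system T := [set A | exists W' : set I,
  [/\ finite_set W', W' `<=` W & K `\` \bigcup_(i in W') f i `<=` A]].
have FF : ProperFilter F.
  constructor.
    move=> [W' [fW' sW' KW']]; apply: (nfin W'); split=> // x Kx.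
    by apply: contrapT => nx; exact: (KW' x).
  constructor.
  - by exists set0; split=> //.
  - move=> A B [W1 [f1 s1 h1]] [W2 [f2 s2 h2]]; exists (W1 `|` W2); split.
    + by rewrite finite_setU.
    + by move=> U [/s1|/s2].
    + by rewrite bigcup_setU setDUr => x [/h1 ? /h2 ?].
  - by move=> A B AB [W1 [f1 s1 h1]]; exists W1; split=> // x /h1 /AB.
have FK : F K by exists set0; split=> // x [].
have [x [Kx clx]] := cK F FF FK.
have [i Wi fix_] := KW _ Kx.
have [y [[_ ny] fiy]] : (K `\` f i) `&` f i !=set0.
  apply: clx; last by apply: open_nbhs_nbhs; split=> //; exact: oW.
  by exists [set i]; split=> //; [move=> _ ->|rewrite bigcup_set1].
by [].
Qed.

Lemma sigma_compact_countable_subcover (T : topologicalType)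
    (K : nat -> set T) (W : set (set T)) :
  (forall n, compact (K n)) -> W `<=` open ->
  \bigcup_n K n `<=` \bigcup_(U in W) U ->
  exists W' : set (set T),
    [/\ countable W', W' `<=` W & \bigcup_n K n `<=` \bigcup_(U in W') U].
Proof.
move=> cK oW KW.
have H n : exists W' : set (set T),
    [/\ finite_set W', W' `<=` W & K n `<=` \bigcup_(U in W') U].
  apply: (compact_finite_subcover (f := id)) => //.
  by move=> x Kx; apply: KW; exists n.
pose W' := \bigcup_n projT1 (cid (H n)); exists W'; split.
- apply: bigcup_countable => // n _; apply: finite_set_countable.
  by have [] := projT2 (cid (H n)).
- by move=> U [n _]; have [_ + _] := projT2 (cid (H n)); exact.
- move=> x [n _ Kx]; have [_ _ /(_ _ Kx)[U WU Ux]] := projT2 (cid (H n)).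
  by exists U => //; exists n.
Qed.

(** * Compact subsets have countable spread *)

Lemma countable_inj (T U : Type) (A : set T) (B : set U) (f : T -> U) :
  countable B -> (forall x, A x -> B (f x)) ->
  (forall x y, A x -> A y -> f x = f y -> x = y) -> countable A.
Proof.
move=> /countable_injP[g ginj] fB finj; apply/countable_injP.
exists (g \o f) => x y; rewrite !inE => Ax Ay gf.
by apply: finj => //; apply: ginj => //; rewrite inE; exact: fB.
Qed.

Lemma openX (X Y : topologicalType) (U : set X) (V : set Y) :
  open U -> open V -> open (U `*` V).
Proof.
move=> oU oV; rewrite openE => -[x y] [/= Ux Vy].
by exists (U, V) => //=; split; apply: open_nbhs_nbhs.
Qed.

Lemma nbhs_prod_box (X Y : topologicalType) (p : X * Y) (B : set (X * Y)) :
  nbhs p B -> exists U V, [/\ open_nbhs p.1 U, open_nbhs p.2 V & U `*` V `<=` B].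
Proof.
move=> [[U V] /= [Up Vp] UVB]; exists U°, V°; split.
- by split; [exact: open_interior|exact: Up].
- by split; [exact: open_interior|exact: Vp].
- by move=> [x y] [/= /interior_subset Ux /interior_subset Vy]; exact: UVB.
Qed.

Lemma hausdorff_open_sep (X : topologicalType) (x y : X) :
  hausdorff_space X -> x <> y ->
  exists U V, [/\ open_nbhs x U, open_nbhs y V & U `&` V = set0].
Proof.
rewrite open_hausdorff => hX /eqP /hX[[U V] [/set_mem Ux /set_mem Vy] [oU oV UV]].
by exists U, V; split=> //; exact/eqP.
Qed.

Lemma closed_disjoint_nbhs (X : topologicalType) (C : set X) (q : X) :
  regular_space X -> closed C -> ~ C q ->
  exists O, open_nbhs q O /\ closure O `<=` ~` C.
Proof.
move=> rX cC nCq; have /rX[A Aq AC] : nbhs q (~` C).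
  by apply: open_nbhs_nbhs; split=> //; exact: closed_openC.
exists A°; split; first by split; [exact: open_interior|exact: Aq].
by apply: subset_trans AC; apply: closureS; exact: interior_subset.
Qed.

Definition disjoint_open_boxes (X : topologicalType) : set (set X * set X) :=
  [set UV | [/\ open UV.1, open UV.2 & UV.1 `&` UV.2 = set0]].

(** A point a of A is alone in some open set, whose complement in the compact set
    cl A is covered by finitely many of the sets V, where U * V is a box of a
    fixed countable family with a in U and U, V disjoint. These finitely many
    boxes determine a. *)
Lemma relatively_discrete_in_compact_countable (X : topologicalType) (A Q : set X) :
  hausdorff_space X -> discretely_sigma_compact_in (~` @diagonal X) ->
  relatively_discrete A -> A `<=` Q -> compact Q -> countable A.
Proof.
move=> hX hZ dA AQ cQ.
pose D := [set p : X * X | [/\ A p.1, A p.2 & p.1 <> p.2]].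
have [||K [cK KZ DK]] := hZ D; first by move=> p [].
  move=> [x y] [/= Ax Ay xy].
  have [U [oU Ux Uuniq]] := dA _ Ax; have [V [oV Vx Vuniq]] := dA _ Ay.
  exists (U `*` V); split=> //; first exact: openX.
  by move=> [u v] [/= Au Av _] [/= /Uuniq-> // /Vuniq->].
(* Sigma-compactness of the closure of D leaves countably many boxes. *)
pose W := [set O | exists2 UV, @disjoint_open_boxes X UV & O = UV.1 `*` UV.2].
have oW : W `<=` open by move=> _ [[U V] [/= oU oV _] ->]; exact: openX.
have [|W' [cW' W'W W'K]] := sigma_compact_countable_subcover cK oW.
  move=> [x y] [n _ /KZ/= nxy].
  have [U [V [[oU Ux] [oV Vy] UV0]]] := hausdorff_open_sep hX nxy.
  by exists (U `*` V) => //; exists (U, V).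
have clAK x y : closure A x -> closure A y -> x <> y ->
    exists UV, [/\ W' (UV.1 `*` UV.2), @disjoint_open_boxes X UV, UV.1 x & UV.2 y].
  move=> Ax Ay xy; have [|O W'O Oxy] := W'K (x, y).
    apply: DK; split=> // B /nbhs_prod_box[U0 [V0 [[oU0 U0x] [oV0 V0y] UVB]]].
    have [U [V [[oU Ux] [oV Vy] UV0]]] := hausdorff_open_sep hX xy.
    have [|u [Au [Uu U0u]]] := Ax (U `&` U0).
      by apply: open_nbhs_nbhs; split=> //; exact: openI.
    have [|v [Av [Vv V0v]]] := Ay (V `&` V0).
      by apply: open_nbhs_nbhs; split=> //; exact: openI.
    exists (u, v); split; last exact: UVB.
    split=> //= uv; suff : (U `&` V) u by rewrite UV0.
    by split=> //; rewrite uv.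
  have [UV dUV OE] := W'W _ W'O; subst O.
  by case: Oxy => Ux Vy; exists UV; split.
have clAQ : closure A `<=` Q.
  by have /closure_id -> := compact_closed hX cQ; exact: closureS.
have cclA : compact (closure A).
  exact: subclosed_compact (@closed_closure _ A) cQ clAQ.
have isol a : A a -> exists F : set (set (X * X)), [/\ finite_set F,
    F `<=` [set O | W' O /\ exists y, O (a, y)]
  & forall b, A b -> (forall O, F O -> exists y, O (b, y)) -> b = a].
  move=> Aa; have [Ua [oUa Uaa Uauniq]] := dA _ Aa.
  have cC : compact (closure A `&` ~` Ua).
    by apply: compact_closedI => //; exact: open_closedC.
  have [||F [fF FW' CF]] := @compact_finite_subcover X _ _
      [set O | W' O /\ exists y, O (a, y)] (fun O => [set y | O (a, y)]) cC.
  - move=> O [/W'W[[U V] [/= oU oV _] ->] [y [/= Ua' _]]].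
    rewrite (_ : [set _ | _] = V)//.
    by apply/seteqP; split=> z //= [].
  - move=> c [Ac nUac]; have [||ac|UV [W'UV _ Ua' Vc]] := clAK a c.
    + exact: subset_closure.
    + by [].
    + by apply: nUac; rewrite -ac.
    by exists (UV.1 `*` UV.2) => //; split=> //; exists c.
  exists F; split=> // b Ab bF; apply: contrapT => nba.
  have [|O FO Oab] := CF b.
    by split; [exact: subset_closure|move=> /Uauniq-/(_ Ab)].
  have [y Oby] := bF _ FO; have [/W'W[UV [_ _ UV0] OE] _] := FW' _ FO; subst O.
  suff : (UV.1 `&` UV.2) b by rewrite UV0.
  by case: Oby => /= U1 _; case: Oab.
have isol' a : exists F : set (set (X * X)), A a -> [/\ finite_set F,
    F `<=` [set O | W' O /\ exists y, O (a, y)]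
  & forall b, A b -> (forall O, F O -> exists y, O (b, y)) -> b = a].
  by have [/isol[F FP]|] := pselect (A a); [exists F|exists set0].
pose f a := projT1 (cid (isol' a)).
have fP a := projT2 (cid (isol' a)).
apply: (countable_inj (f := f) (countable_finite_subset cW')).
  by move=> a /fP[fF FW' _]; split=> // O /FW'[].
move=> a b Aa Ab fab; have [_ _ buniq] := fP _ Ab.
apply: buniq => // O; rewrite -/(f b) -fab => FO.
by have [_ /(_ _ FO)[]] := fP _ Aa.
Qed.

(** * Compact subsets and their squares are countably tight *)

Lemma filter_finite_bigcap (I T : Type) (F : set_system T) (D : set I)
    (f : I -> set T) :
  Filter F -> finite_set D -> (forall i, D i -> F (f i)) ->
  F (\bigcap_(i in D) f i).
Proof.
elim/Pchoice: I => I in D f *.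
move=> FF /finite_fsetP[D' ->] Ff; apply: filter_bigI => i iD'.
exact: Ff.
Qed.

Definition countably_closed (T : topologicalType) (A : set T) : Prop :=
  forall C, countable C -> C `<=` A -> closure C `<=` A.

(** For each finite subfamily of N choose a point of A in its intersection. If no
    point of the closure of these countably many points met all closures, then
    by compactness finitely many members of N would already exclude the point
    chosen for them. *)
Lemma countably_closed_bigcap_closure (X : topologicalType) (A Q : set X)
    (q : X) (N : set (set X)) :
  hausdorff_space X -> compact Q -> A `<=` Q -> countably_closed A ->
  closure A q -> countable N -> (forall O, N O -> nbhs q O) ->
  exists2 a, A a & forall O, N O -> closure O a.
Proof.
move=> hX cQ AQ ccA Aq cN Nq.
have pick (F : set (set X)) : exists a, F `<=` N -> finite_set F ->
    A a /\ forall O, F O -> O a.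
  have [[FN fF]|nF] := pselect (F `<=` N /\ finite_set F); last first.
    by exists q => FN fF; case: nF.
  have [|a [Aa Fa]] := Aq (\bigcap_(O in F) O); last by exists a.
  by apply: filter_finite_bigcap => // O /FN /Nq.
pose a F := projT1 (cid (pick F)); have aP F := projT2 (cid (pick F)).
pose C := a @` [set F | F `<=` N /\ finite_set F].
have cC : countable C.
  apply: sub_countable (countable_finite_subset cN); exact: card_image_le.
have CA : C `<=` A by move=> _ [F [FN fF] <-]; have [] := aP F FN fF.
have clCA := ccA _ cC CA.
have cclC : compact (closure C).
  apply: subclosed_compact (@closed_closure _ C) cQ _.
  exact: subset_trans AQ.
apply: contrapT => nex.
have [||F [fF FN CF]] := @compact_finite_subcover X _ _ N
    (fun O => ~` closure O) cclC.
- by move=> O _; apply: closed_openC; exact: closed_closure.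
- move=> x clCx; apply: contrapT => nx; apply: nex; exists x; first exact: clCA.
  by move=> O NO; apply: contrapT => nO; apply: nx; exists O.
- have [_ aF] := aP F FN fF.
  have [|O FO] := CF (a F); first by apply: subset_closure; exists F.
  by apply; apply: subset_closure; exact: aF.
Qed.

(** If q is in cl A but not in A, choose along omega_1 points x_i of A outside the
    closure of the earlier ones, and neighbourhoods O_i of q with x_i outside
    cl O_i and all later points inside it. Each x_i is then isolated from the
    earlier and from the later points. *)
Lemma countably_closed_closed (X : topologicalType) (A Q : set X) :
  hausdorff_space X -> regular_space X ->
  discretely_sigma_compact_in (~` @diagonal X) ->
  compact Q -> A `<=` Q -> countably_closed A -> closed A.
Proof.
move=> hX rX hZ cQ AQ ccA q Aq; apply: contrapT => nAq.
have [I [lt omI]] := omega1_order_exists.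
(* Stage i of the recursion yields the pair (x_i, O_i). *)
pose P (S : set (X * set X)) (t : X * set X) :=
  (forall s, S s -> A s.1 /\ open_nbhs q s.2) ->
  [/\ A t.1, open_nbhs q t.2, ~ closure t.2 t.1,
      forall s, S s -> closure s.2 t.1 & ~ closure (fst @` S) t.1].
have [S cS|t tP] := omega1_recursion (P := P) omI.
  have [Sgood|nS] := pselect (forall s, S s -> A s.1 /\ open_nbhs q s.2);
    last by exists (q, setT).
  have cS1 : countable (fst @` S) by apply: sub_countable cS; exact: card_image_le.
  have S1A : fst @` S `<=` A by move=> _ [s /Sgood[? _] <-].
  have [||O [qO clO]] := @closed_disjoint_nbhs X (closure (fst @` S)) q rX.
  - exact: closed_closure.
  - by move=> /(ccA _ cS1 S1A).
  have [||a Aa aN] := @countably_closed_bigcap_closure X A Q q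
    (snd @` S `|` [set O]) hX cQ AQ ccA Aq.
  - apply: countable_setU; last exact: countable1.
    by apply: sub_countable cS; exact: card_image_le.
  - move=> _ [[s /Sgood[_ ?] <-]|->]; exact: open_nbhs_nbhs.
  have naq : q <> a by move=> qa; apply: nAq; rewrite qa.
  have [||O' [qO' clO']] := @closed_disjoint_nbhs X [set a] q rX.
  - by apply: accessible_closed_set1; exact: hausdorff_accessible.
  - by move=> /naq.
  exists (a, O') => _; split=> //=.
  - by move=> /clO'; exact.
  - by move=> s Ss; apply: aN; left; exists s.
  - by apply: clO; apply: aN; right.
have [wf tr tot unc cseg] := omI.
have good i : A (t i).1 /\ open_nbhs q (t i).2.
  elim/(well_founded_ind wf): i => i IH.
  by have [|? ? _ _ _] := tP i; [move=> _ [j /IH ? <-]|].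
have tP' i : [/\ ~ closure (t i).2 (t i).1,
    forall j, lt j i -> closure (t j).2 (t i).1
    & ~ closure [set (t j).1 | j in [set j | lt j i]] (t i).1].
  have [|_ _ h1 h2 h3] := tP i; first by move=> _ [j _ <-].
  split=> // [j ji|]; first by apply: h2; exists j.
  by rewrite image_comp in h3.
have lt_inj i j : lt i j -> (t i).1 <> (t j).1.
  move=> ij e; have [_ _] := tP' j; apply; rewrite -e.
  by apply: subset_closure; exists i.
have t_inj i j : (t i).1 = (t j).1 -> i = j.
  by move=> e; case: (tot i j) => // /lt_inj; rewrite e.
apply: unc; have cA : countable (range (fun i => (t i).1)).
  apply: (relatively_discrete_in_compact_countable hX hZ _ _ cQ); last first.
    by move=> _ [i _ <-]; apply: AQ; case: (good i).
  move=> _ [i _ <-]; have [h1 h2 h3] := tP' i.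
  exists (~` closure (t i).2 `&` ~` closure [set (t j).1 | j in [set j | lt j i]]).
  split=> //.
    by apply: openI; apply: closed_openC; exact: closed_closure.
  move=> _ [j _ <-] [g1 g2]; case: (tot i j) => [ij|->//|ji].
    by case: g1; have [_ + _] := tP' j; exact.
  by case: g2; apply: subset_closure; exists j.
by apply: (countable_inj (f := fun i => (t i).1) cA) => [i _|i j _ _ /t_inj//]; exists i.
Qed.

(** A countable subset of the projection lifts to a countable subset of T, whose
    closure is compact and has therefore a closed projection. *)
Lemma countably_closed_proj1 (X : topologicalType) (Q : set X) (T : set (X * X)) :
  hausdorff_space X -> regular_space X ->
  discretely_sigma_compact_in (~` @diagonal X) ->
  compact Q -> T `<=` Q `*` Q -> countably_closed T -> closed (fst @` T).
Proof.
move=> hX rX hZ cQ TQ ccT; have clQ := compact_closed hX cQ.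
have clQQ : closed (Q `*` Q).
  move=> [x y] Bxy; split=> /=; apply: clQ => B Bx.
  - have [|[u v] [[/= Qu _] [/= Bu _]]] := Bxy (B `*` setT); last by exists u.
    by exists (B, setT) => //=; split=> //; exact: filterT.
  - have [|[u v] [[/= _ Qv] [/= _ Bv]]] := Bxy (setT `*` B); last by exists v.
    by exists (setT, B) => //=; split=> //; exact: filterT.
apply: (countably_closed_closed hX rX hZ cQ); first by move=> _ [p /TQ[? _] <-].
move=> C cC CT.
have lift x : exists p, C x -> T p /\ p.1 = x.
  have [/CT[p Tp <-]|nC] := pselect (C x); first by exists p.
  by exists (x, x).
pose l x := projT1 (cid (lift x)); have lP x := projT2 (cid (lift x)).
have clT : closure (l @` C) `<=` T.
  apply: ccT; first by apply: sub_countable cC; exact: card_image_le.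
  by move=> _ [x /lP[? _] <-].
have cfst : compact (fst @` closure (l @` C)).
  apply: continuous_compact.
    by apply: continuous_subspaceT => p; exact: cvg_fst.
  apply: subclosed_compact (@closed_closure _ _) (compact_setX cQ cQ) _.
  exact: subset_trans TQ.
have /closure_id clf := compact_closed hX cfst.
apply: (subset_trans (B := fst @` closure (l @` C))).
  rewrite clf; apply: closureS => x Cx; exists (l x).
    by apply: subset_closure; exists x.
  by have [] := lP x Cx.
exact: image_subset.
Qed.

(** Let (u, v) be in cl T. The fibre of T over u is closed, so if v is not in it,
    some closed neighbourhood V of v misses it. The part of T of height in V has
    a closed projection, which contains u: this is a point of the fibre in V. *)
Lemma countably_closed_closed_prod (X : topologicalType) (Q : set X)
    (T : set (X * X)) :
  hausdorff_space X -> regular_space X ->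
  discretely_sigma_compact_in (~` @diagonal X) ->
  compact Q -> T `<=` Q `*` Q -> countably_closed T -> closed T.
Proof.
move=> hX rX hZ cQ TQ ccT [u v] Tuv; apply: contrapT => nTuv.
pose Tu := [set y | T (u, y)].
have clTu : closed Tu.
  apply: (countably_closed_closed hX rX hZ cQ); first by move=> y /TQ[].
  move=> C cC CT y Cy; apply: (ccT ((fun y => (u, y)) @` C)).
  - by apply: sub_countable cC; exact: card_image_le.
  - by move=> _ [z /CT ? <-].
  move=> B /nbhs_prod_box[U [V [[_ /= Uu] [oV /= Vy] UVB]]].
  have [|z [Cz Vz]] := Cy V; first by apply: open_nbhs_nbhs.
  by exists (u, z); split; [exists z|exact: UVB].
have [O [[oO Ov] clO]] := closed_disjoint_nbhs rX clTu nTuv.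
have /= TO : closed (fst @` (T `&` (setT `*` closure O))).
  apply: (countably_closed_proj1 hX rX hZ cQ); first by move=> p [/TQ].
  move=> C cC CT p Cp; split.
    by apply: (ccT C) => // z /CT[].
  split=> //=; apply: closed_closure => B Bp.
  have [|z [/CT[_ [_ /= Oz]] [_ /= Bz]]] := Cp (setT `*` B).
    by exists (setT, B) => //=; split=> //; exact: filterT.
  by exists z.2.
have [|[u' y] [Tuy [_ /= Oy]] /= e] := TO u.
  move=> B Bu; have [|p [Tp [/= Bp Op]]] := Tuv (B `*` O).
    by exists (B, O) => //=; split=> //; apply: open_nbhs_nbhs.
  exists p.1; split=> //; exists p => //; split=> //; split=> //=.
  exact: subset_closure.
by subst u'; exact: (clO _ Oy).
Qed.

(** * The complement of the diagonal is Lindelof *)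

Lemma hausdorff_prod (X Y : topologicalType) :
  hausdorff_space X -> hausdorff_space Y -> hausdorff_space (X * Y)%type.
Proof.
move=> hX hY [x y] [x' y'] clxy; congr (_, _).
  apply: hX => A B Ax Bx'.
  have [||[u v] [[/= ? _] [/= ? _]]] := clxy (A `*` setT) (B `*` setT).
  - by exists (A, setT) => //=; split=> //; exact: filterT.
  - by exists (B, setT) => //=; split=> //; exact: filterT.
  by exists u.
apply: hY => A B Ay By'.
have [||[u v] [[/= _ ?] [/= _ ?]]] := clxy (setT `*` A) (setT `*` B).
- by exists (setT, A) => //=; split=> //; exact: filterT.
- by exists (setT, B) => //=; split=> //; exact: filterT.
by exists v.
Qed.

(** The recursion along omega_1 produces pairs (p_i, O_i) with O_i a countable
    union of members of W that contains the closure in Z of the points up to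
    p_i, while p_i avoids every earlier O_j and the closure of the earlier
    points. *)
Lemma offdiagonal_lindelof (X : topologicalType) (W : set (set (X * X))) :
  hausdorff_space X -> regular_space X ->
  discretely_sigma_compact_in (~` @diagonal X) ->
  W `<=` open -> ~` @diagonal X `<=` \bigcup_(U in W) U ->
  exists W' : set (set (X * X)),
    [/\ countable W', W' `<=` W & ~` @diagonal X `<=` \bigcup_(U in W') U].
Proof.
move=> hX rX hZ oW ZW; apply: contrapT => /forallNP nLin.
set Z := ~` @diagonal X in hZ ZW nLin *.
have hXX := hausdorff_prod hX hX.
have [I [lt omI]] := omega1_order_exists.
have [wf tr tot unc cseg] := omI.
pose small (O : set (X * X)) := exists W' : set (set (X * X)),
  [/\ countable W', W' `<=` W & O = \bigcup_(U in W') U].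
have small_open O : small O -> open O.
  by move=> [W' [_ W'W ->]]; apply: bigcup_open => U /W'W; exact: oW.
pose next (S : set ((X * X) * set (X * X))) (t : (X * X) * set (X * X)) :=
  [/\ Z t.1, small t.2, closure (fst @` S `|` [set t.1]) `&` Z `<=` t.2,
      forall s, S s -> ~ s.2 t.1 & ~ closure (fst @` S) t.1].
pose good (S : set ((X * X) * set (X * X))) :=
  [/\ fst @` S `<=` Z, relatively_discrete (fst @` S)
    & forall s, S s -> small s.2].
have [p0 _] : exists p0, Z p0.
  apply: contrapT => nZ; apply: (nLin set0); split=> // p Zp.
  by case: nZ; exists p.
have [S cS|t tP] := omega1_recursion (P := fun S t => good S -> next S t) omI.
  have [[SZ dS sS]|nS] := pselect (good S); last by exists (p0, setT).
  have [K [cK KZ SK]] := hZ _ SZ dS.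
  have [|W1 [cW1 W1W KW1]] := sigma_compact_countable_subcover cK oW.
    by move=> p [n _ /KZ]; exact: ZW.
  have sS' s : exists W' : set (set (X * X)), S s ->
      [/\ countable W', W' `<=` W & s.2 = \bigcup_(U in W') U].
    by have [/sS[W' ?]|] := pselect (S s); [exists W'|exists set0].
  pose W2 := \bigcup_(s in S) projT1 (cid (sS' s)).
  have W2P s := projT2 (cid (sS' s)).
  have cW2 : countable W2 by apply: bigcup_countable => // s /W2P[].
  have [p [Zp npW]] : exists p, Z p /\ ~ (\bigcup_(U in W1 `|` W2) U) p.
    apply: contrapT => nex; apply: (nLin (W1 `|` W2)); split.
    - exact: countable_setU.
    - by move=> U [/W1W//|[s Ss]]; have [_ + _] := W2P s Ss; exact.
    - by move=> p Zp; apply: contrapT => np; apply: nex; exists p.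
  have nclp : ~ closure (fst @` S) p.
    move=> clp; have [U W1U Up] := KW1 p (SK p (conj clp Zp)).
    by apply: npW; exists U => //; left.
  have [U WU Up] := ZW _ Zp.
  exists (p, \bigcup_(U in W1 `|` [set U]) U) => _; split=> //=.
  - exists (W1 `|` [set U]); split=> //.
    + by apply: countable_setU => //; exact: countable1.
    + by move=> V [/W1W//|->].
  - rewrite closureU => q [[clq|clq] Zq].
      have [V W1V Vq] := KW1 q (SK q (conj clq Zq)).
      by exists V => //; left.
    have cp : closed [set p].
      by apply: accessible_closed_set1; exact: hausdorff_accessible.
    by move: clq; rewrite -(closure_id _).1// => ->; exists U => //; right.
  - move=> s Ss; have [_ _ ->] := W2P s Ss => -[V sV Vp]; apply: npW.
    by exists V => //; right; exists s.
pose seg i := t @` [set j | lt j i].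
(* O_i excludes the later points, the closure condition the earlier ones; the
   statement for arbitrary J also serves inside the induction. *)
have isolated (J : set I) : (forall i, J i -> next (seg i) (t i)) ->
    relatively_discrete (fst @` (t @` J)).
  move=> Jnext _ [_ [i Ji <-] <-]; have [Zi si cli _ ncli] := Jnext i Ji.
  exists ((t i).2 `&` ~` closure (fst @` seg i)); split.
  - by apply: openI; [exact: small_open|apply: closed_openC; exact: closed_closure].
  - split=> //; apply: cli; split=> //.
    by apply: subset_closure; right.
  - move=> _ [_ [j Jj <-] <-] [tij nclj]; case: (tot i j) => [ij|->//|ji].
      have [_ _ _ nj _] := Jnext j Jj.
      by exfalso; apply: (nj (t i)) => //; exists i.
    by case: nclj; apply: subset_closure; exists (t j) => //; exists j.
have nextP i : next (seg i) (t i).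
  elim/(well_founded_ind wf): i => i IH; apply: tP; split.
  - by move=> _ [_ [j /IH[? _ _ _ _] <-] <-].
  - by apply: isolated => j; exact: IH.
  - by move=> _ [j /IH[_ ? _ _ _] <-].
pose p i := (t i).1; pose O i := (t i).2.
have pZ i : Z (p i) by have [] := nextP i.
have oO i : open (O i) by have [_ /small_open] := nextP i.
have pO i j : lt i j -> ~ O i (p j).
  by move=> ij; have [_ _ _ + _] := nextP j; apply; exists i.
have clO i : closure (p @` [set j | lt j i]) `&` Z `<=` O i.
  move=> q [clq Zq]; have [_ _ + _ _] := nextP i; apply; split=> //.
  apply: closureS clq => _ [j ji <-]; left; exists (t j) => //.
  by exists j.
have [||K [cK KZ DK]] := hZ (range p).
- by move=> _ [i _ <-].
- by have := isolated setT (fun i _ => nextP i); rewrite image_comp.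
(* The first uncountable ordinal is not a countable union of countable sets. *)
have [n uncJ] : exists n, ~ countable [set i | K n (p i)].
  apply: contrapT => /forallNP cJ; apply: unc.
  rewrite (_ : [set: I] = \bigcup_n [set i | K n (p i)]).
    by apply: bigcup_countable => // n _; apply: contrapT; exact: cJ.
  apply/seteqP; split=> // i _.
  have [|n _ Kn] := DK (p i); last by exists n.
  by split=> //; apply: subset_closure; exists i.
pose Q := fst @` K n `|` snd @` K n.
have cQ : compact Q.
  apply: compactU; apply: continuous_compact => //;
    apply: continuous_subspaceT => z; [exact: cvg_fst|exact: cvg_snd].
(* T is the set of limits of countable pieces of the subsequence in K n. *)
pose T_ i := closure (p @` [set j | K n (p j) /\ lt j i]).
pose T := \bigcup_i T_ i.
have T_mono i j : lt i j -> T_ i `<=` T_ j.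
  move=> ij; apply: closureS => _ [k [Kk ki] <-]; exists k => //; split=> //.
  exact: tr ki ij.
have TK : T `<=` K n.
  move=> q [i _]; have /closure_id -> := compact_closed hXX (cK n).
  by apply: closureS => _ [j [Kj _] <-].
have ccT : countably_closed T.
  move=> C cC CT.
  have ex q : exists i, C q -> T_ i q.
    have [/CT[i _ Ti]|nC] := pselect (C q); first by exists i.
    by have [i _] := omega1_bounded omI (countable0 _); exists i.
  pose idx q := projT1 (cid (ex q)); have idxP q := projT2 (cid (ex q)).
  have [|i iP] := @omega1_bounded _ _ (idx @` C) omI.
    by apply: sub_countable cC; exact: card_image_le.
  move=> q Cq; exists i => //.
  have -> : T_ i = closure (T_ i) by apply/closure_id; exact: closed_closure.
  apply: closureS Cq => r Cr; apply: (@T_mono (idx r)); last exact: idxP.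
  by apply: iP; exists r.
have clT : closed T.
  apply: (countably_closed_closed_prod hX rX hZ cQ) => // q /TK Kq.
  by split; [left|right]; exists q.
have cT : compact T by exact: subclosed_compact clT (cK n) TK.
have [||F [fF _ TF]] := @compact_finite_subcover _ _ T setT O cT.
- by move=> i _; exact: oO.
- move=> q Tq; have [i _ Ti] := Tq; exists i => //; apply: clO.
  split; last exact: KZ (TK _ Tq).
  by apply: closureS Ti => _ [j [_ ji] <-]; exists j.
have [i0 i0P] := omega1_bounded omI (finite_set_countable fF).
have [j [Kj nji0]] : exists j, K n (p j) /\ ~ lt j i0.
  apply: contrapT => nex; apply: uncJ; apply: sub_countable (cseg i0).
  apply: subset_card_le => j Kj; apply: contrapT => nj; apply: nex.
  by exists j.
have [i iP] := omega1_bounded omI (countable1 j).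
have [|k Fk] := TF (p j).
  exists i => //; apply: subset_closure; exists j => //.
  by split=> //; exact: iP.
apply: pO; case: (tot j i0) => [//|->|i0j]; first exact: i0P.
by apply: tr i0j; exact: i0P.
Qed.

(** * Separating sequences and Lindelof Sigma-spaces *)

Lemma tychonoff_hausdorff (R : realType) (X : topologicalType) :
  tychonoff_space X -> hausdorff_space X.
Proof.
move=> [aX cX]; have rX := completely_regular_regular (R := R) cX.
rewrite open_hausdorff => x y xy.
have [||O [[oO Ox] clO]] := @closed_disjoint_nbhs X [set y] x rX.
- exact: accessible_closed_set1.
- by move=> yx; move: xy; rewrite yx eqxx.
exists (O, ~` closure O) => /=.
  by split; apply/mem_set => // /clO; exact.
split=> //; first by apply: closed_openC; exact: closed_closure.
by apply/eqP/disjoints_subset; rewrite setCK; exact: subset_closure.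
Qed.

(** Separation is required with a strict gap at 1/2, so that {f n < 1/2} and
    {f n > 1/2} are disjoint open sets separating x from y. *)
Definition separating_sequence (R : realType) (X : topologicalType)
    (f : nat -> X -> R) : Prop :=
  [/\ forall n, continuous (f n), forall n x, (0 <= f n x <= 1)%R
    & forall x y, x <> y -> exists n, (f n x < 2^-1 /\ 2^-1 < f n y)%R].

Lemma countable_enumeration (T : Type) (A : set T) (t0 : T) :
  countable A ->
  exists e : nat -> T, A `<=` range e /\ forall n, e n = t0 \/ A (e n).
Proof.
move=> /countable_injP[g ginj].
have ex n : exists t, (A t /\ g t = n) \/ (t = t0 /\ forall s, A s -> g s <> n).
  have [[t tP]|nt] := pselect (exists t, A t /\ g t = n); first by exists t; left.
  by exists t0; right; split=> // s As gs; apply: nt; exists s.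
exists (fun n => projT1 (cid (ex n))); split=> [t At|n].
  exists (g t) => //; case: cid => s /= [[As gst]|[_ /(_ t At)//]].
  by apply: ginj; rewrite ?inE.
by case: cid => s /= [[]|[]]; [right|left].
Qed.

Lemma separating_sequence_exists (R : realType) (X : topologicalType) :
  tychonoff_space X -> discretely_sigma_compact_in (~` @diagonal X) ->
  exists f : nat -> X -> R, separating_sequence f.
Proof.
move=> tX hZ; have hX := tychonoff_hausdorff R tX; have [aX cX] := tX.
have rX := completely_regular_regular (R := R) cX.
pose fun01 : set (X -> R) :=
  [set g : X -> R | continuous g /\ forall x, (0 <= g x <= 1)%R].
pose box (g : X -> R) := [set p : X * X | (g p.1 < 2^-1 /\ 2^-1 < g p.2)%R].
have box_open g : fun01 g -> open (box g).
  move=> [cg _].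
  rewrite (_ : box g = (g @^-1` [set r | r < 2^-1]%R) `*` (g @^-1` [set r | 2^-1 < r]%R)).
    by apply: openX; apply: open_comp.
  by apply/seteqP; split=> p []; split.
have [||W [cW Wbox ZW]] := @offdiagonal_lindelof X (box @` fun01) hX rX hZ.
- by move=> _ [g /box_open ? <-].
- move=> [x y] /= nxy.
  have /(uniform_separatorP (R := R))[g [cg g01 gx gy]] :
      uniform_separator [set x] [set y].
    by apply: cX; [exact: accessible_closed_set1|exact: nxy].
  exists (box g); first by exists g => //; split=> // z; have := g01 (g z); apply; exists z.
  have gx0 : g x = 0%R by apply: gx; exists x.
  have gy1 : g y = 1%R by apply: gy; exists y.
  by rewrite /box/= gx0 gy1 invr_gt0 ltr0n invf_lt1 ?ltr0n// ltr1n.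
have ex O : exists g, W O -> fun01 g /\ O = box g.
  have [/Wbox[g g01 <-]|] := pselect (W O); first by exists g.
  by exists (fun=> 0%R).
pose g O := projT1 (cid (ex O)); have gP O := projT2 (cid (ex O)).
have [|e [We eW]] := @countable_enumeration _ (g @` W) (fun=> 0%R).
  by apply: sub_countable cW; exact: card_image_le.
have e01 n : fun01 (e n).
  case: (eW n) => [->|[O /gP[? _] <-]//]; split=> [x|x]; first exact: cvg_cst.
  lra.
exists e; split=> [n|n|x y xy]; [by have [] := e01 n|by have [] := e01 n|].
have [O WO Oxy] := ZW (x, y) xy.
have [|n _ en] := We (g O); first by exists O.
by exists n; rewrite en; have [_ OE] := gP O WO; rewrite OE in Oxy.
Qed.

Lemma open_superlevel (R : realType) (X : topologicalType) (g : X -> R) (r : R) :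
  continuous g -> open [set x | (r < g x)%R].
Proof.
move=> cg; rewrite (_ : [set _ | _] = g @^-1` [set s | r < s]%R)//.
by apply: open_comp.
Qed.

(** Let x be in U and in the compact set K of the cover. By compactness of K minus
    U, finitely many n with f n x < 1/2 are such that the sets {f n > 1/2} cover
    it. A network member between K and the union of U with these sets, cut down
    by the conditions f n < 1/2, lies between x and U. *)
Lemma lindelof_sigma_cosmic (R : realType) (X : topologicalType)
    (f : nat -> X -> R) :
  separating_sequence f -> lindelof_sigma_space X -> cosmic X.
Proof.
move=> [cf f01 fsep] [_ [F [C [cF covC Ccpt netF]]]].
pose lower (G : set nat) := \bigcap_(n in G) [set x | (f n x < 2^-1)%R].
pose cell (AG : set X * set nat) := AG.1 `&` lower AG.2.
exists (cell @` (F `*` [set G | G `<=` setT /\ finite_set G])).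
  apply: sub_countable (card_image_le _ _) _.
  apply: countableX => //; apply: countable_finite_subset; exact: countableP.
move=> U oU; exists [set B | (cell @` (F `*` [set G | G `<=` setT /\ finite_set G])) B /\ B `<=` U].
  by move=> B [].
apply/seteqP; split=> [x Ux|x [B [_ BU] Bx]]; last exact: BU.
have [K CK Kx] : cover C id x by rewrite covC.
have cKU : compact (K `&` ~` U).
  by apply: compact_closedI; [exact: Ccpt|exact: open_closedC].
have [||G [fG Gx KG]] := @compact_finite_subcover X _ _
    [set n | (f n x < 2^-1)%R] (fun n => [set y | (2^-1 < f n y)%R]) cKU.
- by move=> n _; exact: open_superlevel.
- move=> y [Ky nUy]; have [|n [xn yn]] := fsep x y; last by exists n.
  by move=> xy; apply: nUy; rewrite -xy.
have [||A [FA KA AU]] := netF K (U `|` \bigcup_(n in G) [set y | (2^-1 < f n y)%R]) CK.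
- apply: openU => //; apply: bigcup_open => n _.
  exact: open_superlevel.
- move=> y Ky; have [|nUy] := pselect (U y); first by left.
  by right; exact: KG.
exists (cell (A, G)); last by split; [exact: KA|move=> n /Gx].
split; first by exists (A, G).
move=> y [/AU[//|[n Gn /= yn]] /(_ n Gn) /=].
lra.
Qed.

(** * Pseudocompact spaces with a separating sequence *)

Local Open Scope ring_scope.

Definition unit_seq (R : realType) (z : nat -> R) : Prop := forall n, 0 <= z n <= 1.

(** The product metric of the Hilbert cube. *)
Definition seq_dist (R : realType) (z w : nat -> R) : R :=
  sup (range (fun n => n.+1%:R^-1 * `|z n - w n|)).

Lemma unit_seq_dist_le1 (R : realType) (z w : nat -> R) (n : nat) :
  unit_seq z -> unit_seq w -> n.+1%:R^-1 * `|z n - w n| <= n.+1%:R^-1.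
Proof.
move=> /(_ n) z01 /(_ n) w01; rewrite ler_piMr ?invr_ge0//.
by rewrite ler_norml; lra.
Qed.

Lemma seq_dist_ub (R : realType) (z w : nat -> R) (n : nat) :
  unit_seq z -> unit_seq w -> n.+1%:R^-1 * `|z n - w n| <= seq_dist z w.
Proof.
move=> z01 w01; apply: ub_le_sup; last by exists n.
exists 1 => _ [m _ <-]; apply: (le_trans (unit_seq_dist_le1 m z01 w01)).
by rewrite invf_le1 ?ltr0n// ler1n.
Qed.

Lemma seq_dist_le (R : realType) (z w : nat -> R) (e : R) :
  (forall n, n.+1%:R^-1 * `|z n - w n| <= e) -> seq_dist z w <= e.
Proof.
move=> h; apply: ge_sup; first by exists (0.+1%:R^-1 * `|z 0%N - w 0%N|), 0%N.
by move=> _ [n _ <-].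
Qed.

Lemma seq_dist_ge0 (R : realType) (z w : nat -> R) :
  unit_seq z -> unit_seq w -> 0 <= seq_dist z w.
Proof.
move=> z01 w01; apply: le_trans (seq_dist_ub 0%N z01 w01).
by rewrite mulr_ge0 ?invr_ge0.
Qed.

Lemma seq_distxx (R : realType) (z : nat -> R) : unit_seq z -> seq_dist z z = 0.
Proof.
move=> z01; apply/eqP; rewrite eq_le seq_dist_ge0// andbT.
by apply: seq_dist_le => n; rewrite subrr normr0 mulr0.
Qed.

Lemma seq_distC (R : realType) (z w : nat -> R) : seq_dist z w = seq_dist w z.
Proof.
rewrite /seq_dist; under eq_fun do rewrite distrC.
by [].
Qed.

Lemma seq_dist_eq0 (R : realType) (z w : nat -> R) :
  unit_seq z -> unit_seq w -> seq_dist z w = 0 -> z = w.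
Proof.
move=> z01 w01 d0; apply/funext => n; have := seq_dist_ub n z01 w01.
by rewrite d0 pmulr_rle0 ?invr_gt0 ?ltr0n// normr_le0 subr_eq0 => /eqP.
Qed.

Lemma seq_dist_triangle (R : realType) (w z v : nat -> R) :
  unit_seq z -> unit_seq w -> unit_seq v ->
  seq_dist z v <= seq_dist z w + seq_dist w v.
Proof.
move=> z01 w01 v01; apply: seq_dist_le => n.
apply: (le_trans (y := n.+1%:R^-1 * `|z n - w n| + n.+1%:R^-1 * `|w n - v n|)).
  by rewrite -mulrDr ler_wpM2l ?invr_ge0// ler_distD.
by apply: lerD; exact: seq_dist_ub.
Qed.

(** Coordinates beyond N contribute at most 1 / (N + 1), so closeness in finitely
    many coordinates suffices. *)
Lemma near_seq_dist (R : realType) (T : Type) (F : set_system T)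
    (f : nat -> T -> R) (z : nat -> R) (e : R) :
  Filter F -> unit_seq z -> (forall x, unit_seq (f^~ x)) ->
  (forall n, f n @ F --> z n) -> 0 < e -> F [set x | seq_dist z (f^~ x) < e].
Proof.
move=> FF z01 f01 fz e0; have e20 : 0 < e / 2 by rewrite divr_gt0.
have [N _ hN] := near_infty_natSinv_lt (PosNum e20).
have : F (\bigcap_(n in `I_N) [set x | `|z n - f n x| < e / 2]).
  apply: filter_finite_bigcap; first exact: finite_II.
  by move=> n _; exact: (cvgr_dist_lt _ _ (fz n) _ e20).
apply: filterS => x hx /=; apply: (@le_lt_trans _ _ (e / 2)); last by lra.
apply: seq_dist_le => n; have [nN|Nn] := ltnP n N.
  apply: le_trans (ltW (hx n nN)); rewrite ler_piMl//.
  by rewrite invf_le1 ?ltr0n// ler1n.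
apply: (le_trans (unit_seq_dist_le1 n z01 (f01 x))); apply: ltW.
by have := hN n Nn.
Qed.

Lemma continuous_seq_dist (R : realType) (X : topologicalType)
    (f : nat -> X -> R) (z : nat -> R) :
  (forall n, continuous (f n)) -> unit_seq z -> (forall x, unit_seq (f^~ x)) ->
  continuous (fun x => seq_dist z (f^~ x)).
Proof.
move=> cf z01 f01 x; apply/cvgrPdist_lt => e e0.
have near_x : nbhs x [set y | seq_dist (f^~ x) (f^~ y) < e].
  by apply: near_seq_dist => // n; exact: cf.
near=> y; have xy : seq_dist (f^~ x) (f^~ y) < e by near: y.
 rewrite ltr_norml.
have := seq_dist_triangle z01 (f01 x) (f01 y).
have := seq_dist_triangle z01 (f01 y) (f01 x).
rewrite (seq_distC (f^~ y)); lra.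
Unshelve. all: by end_near. Qed.

(** The inverse of k is continuous, hence bounded. *)
Lemma pseudocompact_positive_lower_bound (R : realType) (X : topologicalType)
    (k : X -> R) :
  pseudocompact R X -> continuous k -> (forall x, 0 < k x) ->
  exists2 e : R, 0 < e & forall x, e <= k x.
Proof.
move=> pX ck k0; have [|M [_ hM]] := pX (fun x => (k x)^-1).
  by move=> x; apply: continuousV; [rewrite gt_eqF|exact: ck].
pose B := `|M| + 1; have B0 : 0 < B by rewrite ltr_wpDl.
have MB : M < B by rewrite ltr_pwDr// ler_norm.
exists B^-1; first by rewrite invr_gt0.
move=> x; rewrite -[k x]invrK lef_pV2 ?posrE ?invr_gt0//.
apply: le_trans (ler_norm _) _; exact: (hM B MB x).
Qed.

(** Let g be continuous with g x = 0 and g = 1 off O. The function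
    rho(x, y) + (1 - g y) of y is positive, since its first term vanishes only at
    x; off O it equals rho(x, y), and it has a positive lower bound. *)
Lemma pseudocompact_fine_nbhs (R : realType) (X : topologicalType)
    (f : nat -> X -> R) (x : X) (O : set X) :
  tychonoff_space X -> pseudocompact R X -> separating_sequence f ->
  nbhs x O ->
  exists2 e : R, 0 < e & forall y, seq_dist (f^~ x) (f^~ y) < e -> O y.
Proof.
move=> [aX cX] pX [cf f01 fsep] Ox.
have f01' y : unit_seq (f^~ y) by move=> n; exact: f01.
have /(uniform_separatorP (R := R))[g [cg g01 gx gO]] :
    uniform_separator [set x] (~` O°).
  apply: cX; first by apply: open_closedC; exact: open_interior.
  by apply; exact: Ox.
have gx0 : g x = 0 by apply: gx; exists x.
have g1 y : g y <= 1 by have := g01 (g y); rewrite /= in_itv/=; case/(_ _)/andP; [exists y|].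
pose k y := seq_dist (f^~ x) (f^~ y) + (1 - g y).
have d0 y := seq_dist_ge0 (f01' x) (f01' y).
have [||e e0 ke] := @pseudocompact_positive_lower_bound R X k pX.
- move=> y; apply: cvgD; first exact: continuous_seq_dist.
  by apply: cvgB; [exact: cvg_cst|exact: cg].
- move=> y; rewrite /k; have := d0 y; have := g1 y.
  have [xy|xy] := pselect (x = y); first by rewrite -xy gx0; lra.
  suff : seq_dist (f^~ x) (f^~ y) != 0 by move=> /eqP; lra.
  apply/eqP => /(seq_dist_eq0 (f01' x) (f01' y)) fxy.
  have [n] := fsep x y xy.
  by move: (congr1 (fun h => h n) fxy) => /= ->; lra.
exists e => // y; apply: contraPP => nOy.
have gy1 : g y = 1 by apply: gO; exists y => // /interior_subset.
by have := ke y; rewrite /k gy1 => ? /=; lra.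
Qed.

Lemma ultra_cvg_compact (X : Type) (T : topologicalType) (U : set_system X)
    (K : set T) (g : X -> T) :
  UltraFilter U -> compact K -> (forall x, K (g x)) ->
  exists2 z, K z & g @ U --> z.
Proof.
move=> UU cK gK; have UK : (g @ U) K.
  by apply: (@filterS _ U _ setT) => [x _|]; [exact: gK|exact: filterT].
have [z [Kz clz]] := cK (g @ U) (fmap_proper_filter _ _) UK.
exists z => // B Bz; have [//|nB] := in_ultra_setVsetC (g @^-1` B) UU.
by have [y []] := clz (~` B) B nB Bz.
Qed.

(** Along an ultrafilter the sequences (f n x) converge to a point z of the Hilbert
    cube. The distance to z has no positive lower bound, so it vanishes at some
    x, and the ultrafilter converges to x. *)
Lemma pseudocompact_compact (R : realType) (X : topologicalType)
    (f : nat -> X -> R) :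
  tychonoff_space X -> pseudocompact R X -> separating_sequence f ->
  compact [set: X].
Proof.
move=> tX pX sf; have [cf f01 fsep] := sf.
have f01' y : unit_seq (f^~ y) by move=> n; exact: f01.
rewrite compact_ultra => U UU _.
have lim n : exists z : R, 0 <= z <= 1 /\ f n @ U --> z.
  have [x|z z01 fz] := @ultra_cvg_compact X R U `[0, 1] (f n) UU (@segment_compact _ _ _).
    by rewrite /= in_itv/= f01.
  by exists z; split=> //; move: z01; rewrite /= in_itv.
pose z n := projT1 (cid (lim n)); have zP n := projT2 (cid (lim n)).
have z01 : unit_seq z by move=> n; case: (zP n).
have near_z e : 0 < e -> U [set x | seq_dist z (f^~ x) < e].
  by move=> e0; apply: near_seq_dist => // n; case: (zP n).
have [x zx] : exists x, z = f^~ x.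
  apply: contrapT => nz.
  have [||e e0 ze] :=
    @pseudocompact_positive_lower_bound R X (fun x => seq_dist z (f^~ x)) pX.
  - exact: continuous_seq_dist.
  - move=> x; rewrite lt_neqAle seq_dist_ge0// andbT eq_sym; apply/eqP.
    by move=> /(seq_dist_eq0 z01 (f01' x)) zx; apply: nz; exists x.
  have [x] := filter_ex (near_z e e0).
  by rewrite /= ltNge ze.
exists x; split=> // O Ox.
have [e e0 eO] := pseudocompact_fine_nbhs tX pX sf Ox.
by apply: filterS (near_z e e0) => y; rewrite zx; exact: eO.
Qed.

Lemma metrizable_of_distance (R : realType) (X : topologicalType)
    (d : X -> X -> R) :
  (forall x, d x x = 0) -> (forall x y, d x y = 0 -> x = y) ->
  (forall x y, d x y = d y x) ->
  (forall y x z, d x z <= d x y + d y z) ->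
  (forall x O, nbhs x O <-> exists2 e, 0 < e & forall y, d x y < e -> O y) ->
  metrizable R X.
Proof.
move=> dxx d0 dC dtri nbhsE.
pose XC : choiceType := X.
pose m := isMetric.Build R XC dxx d0 dC dtri.
pose M : metricType R := HB.pack (XC : Type) (Choice.class XC) m.
exists (Metric.class M) => N x; apply/funext => O; apply/propext.
have ballE (e : R) (y : N) : @ball R N x e y = (d x y < e) :> Prop.
  by rewrite (@ballEmdist R N).
rewrite (nbhsE x O); split=> [/(@nbhs_ballP R N)[e /= e0 eO]|[e e0 eO]].
  by exists e => // y xy; apply: eO; rewrite ballE.
by apply/(@nbhs_ballP R N); exists e => //= y; rewrite ballE; exact: eO.
Qed.

Lemma pseudocompact_metrizable (R : realType) (X : topologicalType)
    (f : nat -> X -> R) :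
  tychonoff_space X -> pseudocompact R X -> separating_sequence f ->
  metrizable R X.
Proof.
move=> tX pX sf; have [cf f01 fsep] := sf.
have f01' y : unit_seq (f^~ y) by move=> n; exact: f01.
apply: (metrizable_of_distance (d := fun x y => seq_dist (f^~ x) (f^~ y))).
- by move=> x; exact: seq_distxx.
- move=> x y /(seq_dist_eq0 (f01' x) (f01' y)) fxy; apply: contrapT => xy.
  have [n] := fsep x y xy.
  by move: (congr1 (fun h => h n) fxy) => /= ->; lra.
- by move=> x y; exact: seq_distC.
- by move=> y x z; exact: seq_dist_triangle.
- move=> x O; split=> [|[e e0 eO]]; first exact: pseudocompact_fine_nbhs.
  suff : nbhs x [set y | seq_dist (f^~ x) (f^~ y) < e] by exact: filterS.
  by apply: near_seq_dist => // n; exact: cf.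
Qed.

Local Close Scope ring_scope.

Theorem corollary3p2 (R : realType) (X : topologicalType)
    (hX : tychonoff_space X)
    (hD : discretely_sigma_compact (offdiagonal X)) :
  (pseudocompact R X -> compact [set: X] /\ metrizable R X) /\
  (lindelof_sigma_space X -> cosmic X).
Proof.
have hZ := discretely_sigma_compact_subspace hD.
have [f sf] := separating_sequence_exists R hX hZ.
split; last exact: lindelof_sigma_cosmic sf.
move=> pX; split; first exact: pseudocompact_compact sf.
exact: pseudocompact_metrizable sf.
Qed.
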